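(* Let $(T,X)$ be a semiflow with $X$ a uniform Hausdorff space. If $(T,X)$ is not minimal and is syndetically transitive, then $(T,X)$ is syndetically sensitive.
   Context: A semiflow $(T,X)$ consists of a topological semigroup $T$ with neutral element $e$, a non-singleton topological space $X$, and a jointly continuous map $T\times X\to X$, $(t,x)\mapsto tx$, with $ex=x$ and $t(sx)=(ts)x$ for all $s,t\in T$, $x\in X$. Here $X$ is a Hausdorff uniform space with symmetric uniform structure $\mathscr{U}_X$ inducing its topology; for $x\in X$ and $\varepsilon\in\mathscr{U}_X$, $\varepsilon[x]=\{y\in X:(x,y)\in\varepsilon\}$. A subset $A\subseteq T$ is thick if for every compact $K\subseteq T$ there is $t\in T$ with $Kt\subseteq A$. A subset $S\subseteq T$ is syndetic if there is a compact $K\subseteq T$ such that $Kt\cap S\neq\emptyset$ for all $t\in T$. For $U,V\subseteq X$, $N_T(U,V)=\{t\in T: U\cap t^{-1}V\neq\emptyset\}$. $(T,X)$ is syndetically transitive if $N_T(U,V)$ is syndetic in $T$ for all non-empty open $U,V\subseteq X$. $(T,X)$ is minimal if the orbit $Tx$ is dense in $X$ for every $x\in X$. For $\varepsilon,\delta\in\mathscr{U}_X$ and $x\in X$ put $T^s_{\varepsilon\text{-}\delta}(x)=\{t\in T: t(\delta[x])\subseteq\varepsilon[tx]\}$. $(T,X)$ is syndetically sensitive if there is $\varepsilon\in\mathscr{U}_X$ such that for all $x\in X$ and all $\delta\in\mathscr{U}_X$ the set $T^s_{\varepsilon\text{-}\delta}(x)$ is not thick in $T$. *)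

(* Defs.v *)
From HB Require Import structures.
From mathcomp Require Import all_boot monoid.
From mathcomp Require Import classical_sets topology.

Set Implicit Arguments.
Unset Strict Implicit.
Unset Printing Implicit Defensive.

Local Open Scope classical_set_scope.
Local Open Scope group_scope.

HB.mixin Record Monoid_isTopological T & Topological T & Monoid T := {
  mulg_continuous : continuous (fun p : T * T => p.1 * p.2)
}.

(* Topological semigroups with a neutral element; the topology need not be
   separated. *)
#[short(type="topologicalMonoidType")]
HB.structure Definition TopologicalMonoid :=
  {T of Topological T & Monoid T & Monoid_isTopological T}.

Record semiflow (T : topologicalMonoidType) (X : topologicalType) := Semiflow {
  act :> T -> X -> X;
  act_continuous : continuous (fun p : T * X => act p.1 p.2);
  act1 : forall x, act 1 x = x;
  actM : forall t s x, act t (act s x) = act (t * s) x;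
  act_nonsingleton : ~ exists x : X, [set: X] = [set x]
}.

Section Semigroup.
Variable T : topologicalMonoidType.

Definition thick (A : set T) :=
  forall K : set T, compact K -> exists t, [set k * t | k in K] `<=` A.

Definition syndetic (S : set T) :=
  exists2 K : set T, compact K &
    forall t, [set k * t | k in K] `&` S !=set0.

End Semigroup.

Section Semiflow.
Variables (T : topologicalMonoidType) (X : topologicalType) (f : semiflow T X).

Definition hitting_times (U V : set X) : set T :=
  [set t | U `&` f t @^-1` V !=set0].

Definition syndetically_transitive :=
  forall U V : set X, open U -> U !=set0 -> open V -> V !=set0 ->
    syndetic (hitting_times U V).

Definition orbit (x : X) : set X := [set f t x | t in [set: T]].

Definition minimal := forall x, dense (orbit x).

End Semiflow.

Section Sensitivity.
Variables (T : topologicalMonoidType) (X : uniformType) (f : semiflow T X).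

(* [xsection e x] is the entourage ball usually written e[x]. *)
Definition stable_times (e d : set (X * X)) (x : X) : set T :=
  [set t | f t @` xsection d x `<=` xsection e (f t x)].

Definition syndetically_sensitive :=
  exists2 e : set (X * X), entourage e &
    forall (x : X) (d : set (X * X)), entourage d ->
      ~ thick (stable_times e d x).

End Sensitivity.

(* Main.v *)
Require Import Defs.
From mathcomp Require Import all_boot classical_sets topology.
From mathcomp Require Import monoid boolp.

(** Since some orbit is not dense, there are a point [x0] and a neighbourhood
    [B] of some point [z] whose closure misses the orbit of [x0].  Let [e] be
    an entourage small compared with [B], and suppose that some ball [d[x]]
    were moved inside an [e]-ball at a thick set of times.  Syndetic
    transitivity makes [d[x]] visit two targets at syndetic sets of times:
    a small neighbourhood [V] of [z], with a compact set [K1] of delays, and a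
    neighbourhood [W] of [x0], with a compact set [K2] of delays.  The set [W]
    is chosen after [K1], so close to [x0] that all of [K1 W] avoids [B]
    ([near_compact_act]).  Thickness, applied to the compact product [K1 K2]
    ([compact_mulg]), gives a time [t] such that every [k1 k2 t] keeps [d[x]]
    inside an [e]-ball.  Pick [k2] for which [k2 t] sends a point of [d[x]]
    into [W], and then [k1] for which [k1 k2 t] sends a point of [d[x]] into
    [V].  The image of [d[x]] at the single time [k1 k2 t] then has a point
    near [z] and a point of [k1 W], hence outside [B]; an [e]-ball is too small
    to contain both. *)

Set Implicit Arguments.
Unset Strict Implicit.
Unset Printing Implicit Defensive.

Local Open Scope classical_set_scope.
Local Open Scope group_scope.

Lemma compact_mulg (T : topologicalMonoidType) (A B : set T) :
  compact A -> compact B -> compact [set p.1 * p.2 | p in A `*` B].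
Proof.
move=> cA cB; apply: continuous_compact; last exact: compact_setX.
exact/continuous_subspaceT/mulg_continuous.
Qed.

(** A tube lemma for the action: joint continuity gives for each [k] in [K] a
    product neighbourhood of [(k, x)] acting into [C], and compactness of [K]
    reduces these to finitely many. *)
Lemma near_compact_act (T : topologicalMonoidType) (X : topologicalType)
    (f : semiflow T X) (K : set T) (x : X) (C : set X) :
  compact K -> (forall k, K k -> nbhs (f k x) C) ->
  \forall y \near x, forall k, K k -> C (f k y).
Proof.
move=> /compact_near_coveringP cK KC.
apply: (cK X (nbhs x) (fun y k => C (f k y))) => k /KC Ck.
exact: (@act_continuous _ _ f (k, x) _ Ck).
Qed.

(** A point of the orbit is only known to lie outside an open set [O].
    Regularity shrinks [O] to a [B] with closure inside [O], which leaves the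
    room needed to perturb [x0]. *)
Lemma non_minimal_separated (T : topologicalMonoidType) (X : uniformType)
    (f : semiflow T X) :
  ~ minimal f ->
  exists (x0 z : X) (B : set X),
    nbhs z B /\ forall t, nbhs (f t x0) (~` B).
Proof.
move=> /existsNP[x0] /existsNP[O] /not_implyP[[z Oz]] /not_implyP[oO O0].
have [B zB BO] := uniform_regular (open_nbhs_nbhs (conj oO Oz)).
exists x0, z, B; split=> // t; apply: contrapT => nB.
apply: O0; exists (f t x0); split; last by exists t.
apply: BO => N tN; apply: contrapT => BN0; apply: nB.
by apply: filterS tN => y Ny By; apply: BN0; exists y.
Qed.

(** Two points of an [e]-ball around [c] are compared through [c], and the
    first one is then compared with [z]: these two applications of the triangle
    inequality are paid for by halving twice an entourage whose ball at [z]
    lies in [B]. *)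
Lemma nbhs_absorbs_balls (X : uniformType) (z : X) (B : set X) :
  nbhs z B ->
  exists (V : set X) (e : set (X * X)), [/\ nbhs z V, entourage e &
    forall c, xsection e c `&` V !=set0 -> xsection e c `<=` B].
Proof.
rewrite -{1}filter_from_entourageE => -[A entA AB].
have entA1 : entourage (split_ent A) by exact: entourage_split_ent.
have entA2 : entourage (split_ent (split_ent A)) by exact: entourage_split_ent.
exists (xsection (split_ent A) z).
exists (split_ent (split_ent A) `&` (split_ent (split_ent A))^-1%relation).
split=> [||c [u [/xsectionP[_ cu] /xsectionP zu]] v /xsectionP[cv _]].
- exact: nbhs_entourage.
- by apply: filterI => //; exact: entourage_inv.
apply/AB/xsectionP.
exact: (entourage_split u entA zu (entourage_split c entA1 cu cv)).
Qed.

Theorem theorem6p12 (T : topologicalMonoidType) (X : uniformType)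
    (f : semiflow T X) (hX : hausdorff_space X) :
  ~ minimal f -> syndetically_transitive f -> syndetically_sensitive f.
Proof.
move=> /non_minimal_separated[x0 [z [B [zB x0B]]]] trf.
have [V [e [zV ente eVB]]] := nbhs_absorbs_balls zB.
exists e => // x d entd thk.
have hits (p : X) (P : set X) : nbhs p P ->
    syndetic (hitting_times f (xsection d x)° P°).
  move=> pP; apply: trf; try exact: open_interior; last by exists p.
  by exists x; exact: nbhs_entourage.
have [K1 cK1 K1V] := hits _ _ zV.
have x0W : nbhs x0 [set y | forall k, K1 k -> ~ B (f k y)].
  exact: (near_compact_act cK1 (fun k _ => x0B k)).
have [K2 cK2 K2W] := hits _ _ x0W.
have [t tK] := thk _ (compact_mulg cK1 cK2).
have [_ [[k2 K2k <-] [y [dy yW]]]] := K2W t.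
have [_ [[k1 K1k <-] [y' [dy' yV]]]] := K1V (k2 * t).
have /tK st : [set k * t | k in [set p.1 * p.2 | p in K1 `*` K2]]
    (k1 * (k2 * t)).
  by exists (k1 * k2); [exists (k1, k2) | rewrite mulgA].
have /(_ k1 K1k) := interior_subset yW; apply; rewrite actM.
apply: (eVB _ _ _ (st _ (imageP _ (interior_subset dy)))).
exists (f (k1 * (k2 * t)) y'); split; last exact: interior_subset yV.
exact: st (imageP _ (interior_subset dy')).
Qed.
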